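(* Let $m,n>1$ be integers such that $m\times n$ is odd, and let $u$ be a vertex of the rectangular grid graph $R(m,n)$. If $u$ is even, then the graph $R(m,n)-\{u\}$ has a Hamilton cycle.
   Context: $R(m,n)$ is the graph with vertex set $\{v=(v_x,v_y)\in\mathbb{Z}^2 : 0\le v_x\le m-1,\ 0\le v_y\le n-1\}$, in which $u$ and $v$ are adjacent if and only if $|u_x-v_x|+|u_y-v_y|=1$. A vertex $v$ is called even if $v_x+v_y\equiv 0 \pmod 2$, and odd otherwise. $R(m,n)-\{u\}$ denotes the graph obtained from $R(m,n)$ by deleting the vertex $u$ and all edges incident to it. A Hamilton cycle of a graph $G$ is a cycle in $G$ containing every vertex of $G$. *)

(* Defs.v *)
From mathcomp Require Import all_boot all_order all_algebra.

Set Implicit Arguments.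
Unset Strict Implicit.
Unset Printing Implicit Defensive.

(* Graphs are symmetric irreflexive relations on a finType of vertices.

   The vertex (v_x, v_y) of R(m,n) is the pair v : 'I_m * 'I_n, so
   0 <= v_x <= m - 1 and 0 <= v_y <= n - 1 hold by typing.  In `|i - j|%N the
   difference is the signed one in int, not the truncated one. *)
Definition grid (m n : nat) : rel ('I_m * 'I_n) :=
  fun u v => (`|u.1 - v.1| + `|u.2 - v.2| == 1)%N.

Arguments grid m n u v : clear implicits.

Definition even_vertex (m n : nat) (v : 'I_m * 'I_n) : bool :=
  v.1 + v.2 == 0 %[mod 2].

Definition del_vertex (T : finType) (e : rel T) (u : T) : rel {v : T | v != u} :=
  fun x y => e (val x) (val y).

Arguments del_vertex {T} e u x y.

(* ucycle alone would accept the empty sequence and a single edge traversed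
   back and forth; a cycle in a simple graph has at least three vertices. *)
Definition is_cycle (T : finType) (e : rel T) (c : seq T) : Prop :=
  2 < size c /\ ucycle e c.

Definition hamilton_cycle (T : finType) (e : rel T) (c : seq T) : Prop :=
  is_cycle e c /\ forall v : T, v \in c.

Lemma grid_sym (m n : nat) : symmetric (grid m n).
Proof. by move=> u v; rewrite /grid distnC [X in _ + X]distnC. Qed.

Lemma grid_irr (m n : nat) : irreflexive (grid m n).
Proof. by move=> u; rewrite /grid !distnn. Qed.

(* Main.v *)
Require Import Defs.
From mathcomp Require Import all_boot all_order all_algebra.
From mathcomp Require Import zify.

(** Put the origin of the integer lattice at the deleted vertex.  What is left of
    the grid is then a rectangle [-w, e] x [-s, t] without its origin, and the
    hypotheses (odd sides, even vertex) say exactly that the four extents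
    w, e, s, t have the same parity, with w + e and s + t positive.

    Such a holed rectangle is reached from a 3 x 3 one by widening it two rows or
    two columns at a time: if the extents are odd the 3 x 3 square has the hole
    in its centre, if they are even it has the hole in a corner, and both squares
    have an obvious Hamilton cycle (holed_centre, holed_corner).  Widening
    (holed_widen) works as soon as the cycle runs along one edge of the side that
    is moved outwards.  Hence the induction carries a cycle that uses an edge of
    each of the four sides, a property that widening preserves.

    The two new columns are filled by local moves of one kind only (detour): an
    edge pq of the cycle is replaced by a path p p' q' q through two new adjacent
    vertices.  Two such moves push an edge of the old side outwards across the
    new columns; this creates two horizontal edges, a lower and an upper one,
    each crossing the two-column strip, which further moves then shift downwards
    and upwards one row at a time until the strip is full (ladder).  The
    symmetries of the lattice reduce the four directions to one. *)

Set Implicit Arguments.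
Unset Strict Implicit.
Unset Printing Implicit Defensive.

(** * Edges of a cycle and local detours *)

Section CyclicLinks.
Variable T : eqType.
Implicit Types (c s : seq T) (p q : T) (e : rel T).

(** The closing arc comes first: the list is then a pairmap started at the last
    vertex, so that cutting c anywhere cuts the list of arcs at the same place
    (links_cat), and no rotation of c is ever needed. *)
Definition links c : seq (T * T) :=
  if c is x :: s then pairmap pair (last x s) c else [::].

Definition uses c p q : bool := ((p, q) \in links c) || ((q, p) \in links c).

Lemma usesC c p q : uses c p q = uses c q p.
Proof. by rewrite /uses orbC. Qed.

Lemma path_pairmap e x s :
  path e x s = all (fun a => e a.1 a.2) (pairmap pair x s).
Proof. by elim: s x => //= y s IHs x; rewrite IHs. Qed.

Lemma cycle_links e c : cycle e c = all (fun a => e a.1 a.2) (links c).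
Proof. by case: c => //= x s; rewrite rcons_path path_pairmap andbC. Qed.

Lemma mem_pairmap_pair p q x s :
  (p, q) \in pairmap pair x s ->
  exists s1 s2, s = s1 ++ q :: s2 /\ last x s1 = p.
Proof.
elim: s x => //= y s IHs x; rewrite inE => /orP[/eqP[-> ->]|/IHs].
  by exists [::], s.
by move=> [s1 [s2 [-> <-]]]; exists (y :: s1), s2.
Qed.

(** An arc (p, q) may be the closing one, in which case s1 is empty and the
    default value of the outer last supplies p. *)
Lemma links_split c p q : (p, q) \in links c ->
  exists s1 s2, c = s1 ++ q :: s2 /\ last (last q s2) s1 = p.
Proof.
case: c => // x s pq.
have [s1 [s2 [def_c <-]]] := @mem_pairmap_pair p q (last x s) (x :: s) pq.
exists s1, s2; split=> //.
congr last; rewrite -[RHS]/(last x (x :: s)) def_c.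
by rewrite last_cat.
Qed.

Lemma links_cat s1 q s2 : links (s1 ++ q :: s2) =
  pairmap pair (last q s2) s1 ++
  (last (last q s2) s1, q) :: pairmap pair q s2.
Proof. by case: s1 => //= x s1; rewrite pairmap_cat last_cat. Qed.

Lemma uses_mem c p q : uses c p q -> (p \in c) && (q \in c).
Proof.
wlog pq : p q / (p, q) \in links c => [th|_].
  by case/orP=> h; [|rewrite andbC]; apply: th; rewrite /uses h.
have [s1 [s2 [-> <-]]] := links_split pq.
rewrite [X in _ && X]mem_cat mem_head orbT andbT.
case/lastP: s1 {pq} => [|s1 y]; first exact: (mem_last q s2).
by rewrite last_rcons mem_cat mem_rcons mem_head.
Qed.

(** The basic move, p q being replaced by p p' q' q: every other edge survives,
    and the three new ones are available for the next moves. *)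
Lemma detour e c p q p' q' : symmetric e ->
    ucycle e c -> uses c p q -> p' \notin c -> q' \notin c -> p' != q' ->
    e p p' -> e p' q' -> e q q' ->
  exists c', [/\ ucycle e c',
    forall v, (v \in c') = [|| v == p', v == q' | v \in c],
    [/\ uses c' p p', uses c' p' q' & uses c' q q'] &
    forall a b, uses c a b -> ~~ ((a \in [:: p; q]) && (b \in [:: p; q])) ->
      uses c' a b].
Proof.
move=> e_sym c_cyc; wlog pq : p q p' q' / (p, q) \in links c => [th|_].
  case/orP=> [h *|h p'c q'c p'q' pp' p'q'e qq'].
    by apply: th => //; rewrite /uses h.
  have [|||||||c' [c'_cyc mem_c' [u1 u2 u3] c'_old]] := th q p q' p' h => //.
  - by rewrite /uses h.
  - by rewrite eq_sym.
  - by rewrite e_sym.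
  exists c'; split=> //.
  - by move=> v; rewrite mem_c' orbCA.
  - by split=> //; rewrite usesC.
  move=> a b ab; rewrite !inE => n_ab; apply: c'_old => //.
  by rewrite !inE orbC [(b == _) || _]orbC.
move=> p'c q'c p'q' pp' p'q'e qq'.
(* The arc enters q, so the two new vertices are inserted just before q, whether
   or not (p, q) is the closing arc. *)
have [s1 [s2 [def_c lastp]]] := links_split pq.
have lc := links_cat s1 q s2; rewrite lastp -def_c in lc.
pose c' := s1 ++ p' :: q' :: q :: s2; exists c'.
have lc' := links_cat s1 p' (q' :: q :: s2); rewrite /= lastp -/c' in lc'.
have perm_c' : perm_eq c' (p' :: q' :: c).
  by rewrite /c' def_c -[p' :: q' :: q :: _]/([:: p'; q'] ++ (q :: s2)) perm_catCA.
split.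
- case/andP: c_cyc; rewrite cycle_links lc all_cat /= => /and3P[h1 _ h3] c_uniq.
  apply/andP; split.
    by rewrite cycle_links lc' all_cat /= h1 pp' p'q'e h3 e_sym qq'.
  by rewrite (perm_uniq perm_c') /= inE negb_or p'q' p'c q'c.
- by move=> v; rewrite (perm_mem perm_c') !inE.
- by rewrite /uses lc' !mem_cat !inE !eqxx !orbT.
move=> a b; rewrite /uses lc lc' !mem_cat !inE.
have keep x y : [|| (x, y) \in pairmap pair (last q s2) s1, (x, y) == (p, q) |
    (x, y) \in pairmap pair q s2] -> (x, y) != (p, q) ->
   [|| (x, y) \in pairmap pair (last q s2) s1, (x, y) == (p, p'),
    (x, y) == (p', q'), (x, y) == (q', q) | (x, y) \in pairmap pair q s2].
  by case/or3P=> [->|->|->]; rewrite ?orbT.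
case/orP=> /keep h n_ab; apply/orP; [left|right]; apply: h;
  by apply: contra n_ab => /eqP[-> ->]; rewrite !eqxx ?orbT.
Qed.

Lemma links_map (f : T -> T) c :
  links (map f c) = [seq (f a.1, f a.2) | a <- links c].
Proof.
case: c => //= x s; rewrite last_map; congr cons.
by elim: s x => //= y s IHs x; rewrite IHs.
Qed.

Lemma uses_map (f : T -> T) c p q : uses c p q -> uses (map f c) (f p) (f q).
Proof.
by rewrite /uses links_map => /orP[] h; apply/orP; [left|right];
   apply/mapP; eexists; [exact: h | | exact: h |].
Qed.

End CyclicLinks.

(** * Cycles through a rectangle with a hole at the origin *)

Import GRing.Theory Num.Theory.

Section HoledRectangles.
Local Open Scope ring_scope.

Definition adj : rel (int * int) :=
  fun u v => `|u.1 - v.1| + `|u.2 - v.2| == 1.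

Lemma adj_sym : symmetric adj.
Proof. by move=> u v; rewrite /adj distrC [X in _ + X]distrC. Qed.

(** Detours stacked on top of each other: each one consumes a rung and creates
    the next, so a strip two cells wide is filled in direction d and, of the
    edges of c, only the initial rung is lost. *)
Lemma ladder (c : seq (int * int)) (x y d : int) (k : nat) :
    d = 1 \/ d = -1 -> ucycle adj c -> uses c (x, y) (x + 1, y) ->
    (forall v, v \in c -> x <= v.1 <= x + 1 -> 0 < d * (v.2 - y) <= k%:Z ->
       False) ->
  exists c', [/\ ucycle adj c',
    forall v, (v \in c') =
      (v \in c) || (x <= v.1 <= x + 1) && (0 < d * (v.2 - y) <= k%:Z),
    uses c' (x, y + d * k%:Z) (x + 1, y + d * k%:Z) &
    forall a b, uses c a b ->
      ~~ ((a \in [:: (x, y); (x + 1, y)]) && (b \in [:: (x, y); (x + 1, y)])) ->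
      uses c' a b].
Proof.
move=> d1; elim: k c y => [|k IHk] c y c_cyc xy_c free.
  exists c; split=> //; last by rewrite mulr0 addr0.
  by move=> v; case: (v \in c) => //=; lia.
have [||||||c1 [c1_cyc mem_c1 [_ u1 _] old1]] :=
  @detour _ adj c (x, y) (x + 1, y) (x, y + d) (x + 1, y + d)
    adj_sym c_cyc xy_c.
- by apply/negP => /free /=; case: d1 => ->; lia.
- by apply/negP => /free /=; case: d1 => ->; lia.
- by rewrite xpair_eqE; lia.
- by rewrite /adj /=; lia.
- by rewrite /adj /=; lia.
- by rewrite /adj /=; lia.
have [|c2 [c2_cyc mem_c2 u2 old2]] := IHk c1 (y + d) c1_cyc u1.
  move=> [v1 v2]; rewrite mem_c1 !xpair_eqE /= => /or3P[||/free /= fr].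
  - by case: d1 => ->; lia.
  - by case: d1 => ->; lia.
  by move: fr; case: d1 => ->; lia.
exists c2; split=> //.
- move=> [v1 v2]; rewrite mem_c2 mem_c1 !xpair_eqE /=.
  by case: (_ \in c) => /=; case: d1 => ->; lia.
- suff -> : y + d * (k.+1)%:Z = y + d + d * k%:Z by [].
  by case: d1 => ->; lia.
(* An edge of c cannot be the new rung, whose ends were not yet visited. *)
move=> a b ab n_ab; apply: old2; first exact: old1.
have /andP[/free fa _] := uses_mem ab.
apply/negP => /andP[+ _]; rewrite !inE => /orP[] /eqP def_a;
  by apply: fa; rewrite def_a /=; first lia; case: d1 => ->; lia.
Qed.

Definition vside (c : seq (int * int)) (x : int) :=
  exists y : int, uses c (x, y) (x, y + 1).

Definition hside (c : seq (int * int)) (y : int) :=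
  exists x : int, uses c (x, y) (x + 1, y).

(** The side edges are there for the induction: each one is where the rectangle
    can be widened next. *)
Definition holed (w e s t : nat) := exists c : seq (int * int),
  [/\ ucycle adj c,
      forall v, (v \in c) =
        [&& - w%:Z <= v.1 <= e%:Z, - s%:Z <= v.2 <= t%:Z & v != (0, 0)],
      vside c (- w%:Z) /\ vside c e%:Z & hside c (- s%:Z) /\ hside c t%:Z].

Lemma holed_flip w e s t : holed w e s t -> holed e w s t.
Proof.
pose f (v : int * int) := (- v.1, v.2).
have fK : involutive f by case=> x y; rewrite /f /= opprK.
move=> [c [/andP[c_cyc c_uniq] mem_c [[yw uw] [ye ue]] [[xs us] [xt ut]]]].
exists (map f c); split.
- rewrite /ucycle map_inj_uniq ?c_uniq ?andbT; last exact: inv_inj.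
  rewrite cycle_map; apply: sub_cycle c_cyc => -[x y] [x' y'].
  by rewrite /adj /f /=; lia.
- move=> v; rewrite -[v in LHS]fK mem_map; last exact: inv_inj.
  by rewrite mem_c; case: v => x y; rewrite !xpair_eqE /=; lia.
- split; [exists ye; exact: (uses_map f ue)|exists yw].
  by have := uses_map f uw; rewrite /f /= opprK.
split; [exists (- (xs + 1))|exists (- (xt + 1))]; rewrite usesC.
  by have := uses_map f us; rewrite /f /= opprD subrK.
by have := uses_map f ut; rewrite /f /= opprD subrK.
Qed.

Lemma holed_swap w e s t : holed w e s t -> holed s t w e.
Proof.
pose f (v : int * int) := (v.2, v.1).
have fK : involutive f by case.
move=> [c [/andP[c_cyc c_uniq] mem_c [[yw uw] [ye ue]] [[xs us] [xt ut]]]].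
exists (map f c); split.
- rewrite /ucycle map_inj_uniq ?c_uniq ?andbT; last exact: inv_inj.
  rewrite cycle_map; apply: sub_cycle c_cyc => -[x y] [x' y'].
  by rewrite /adj /f /=; lia.
- move=> v; rewrite -[v in LHS]fK mem_map; last exact: inv_inj.
  by rewrite mem_c; case: v => x y; rewrite !xpair_eqE /=; lia.
- by split; [exists xs; exact: (uses_map f us)|exists xt; exact: (uses_map f ut)].
by split; [exists yw; exact: (uses_map f uw)|exists ye; exact: (uses_map f ue)].
Qed.

Lemma holed_widen w e s t : (0 < w + e)%N -> holed w e s t -> holed w e.+2 s t.
Proof.
move=> we0 [c [c_cyc mem_c [[yw uw] [y ue]] _]].
(* Two detours carry the eastern edge at heights y, y + 1 to columns E + 1 and
   E + 2, and leave a rung at each of these heights. *)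
pose E := e%:Z.
have /andP[] := uses_mem ue; rewrite !mem_c /= => /and3P[_ y1 _] /and3P[_ y2 _].
have [||||||c1 [c1_cyc mem_c1 [_ u1 _] old1]] :=
  @detour _ adj c (E, y) (E, y + 1) (E + 1, y) (E + 1, y + 1) adj_sym c_cyc ue.
1-6: rewrite ?mem_c ?xpair_eqE /adj /=; lia.
have [||||||c2 [c2_cyc mem_c2 [lo2 east2 hi2] old2]] :=
  @detour _ adj c1 (E + 1, y) (E + 1, y + 1) (E + 1 + 1, y) (E + 1 + 1, y + 1)
    adj_sym c1_cyc u1.
1-6: rewrite ?mem_c1 ?mem_c ?xpair_eqE /adj /=; lia.
(* The upper rung climbs to row t and the lower one descends to row -s; there they
   serve as the edges of the northern and southern sides. *)
have [k def_k] : exists k : nat, y + 1 + 1 * k%:Z = t%:Z.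
  by exists (absz (t%:Z - (y + 1))%R); lia.
have [l def_l] : exists l : nat, y + -1 * l%:Z = - s%:Z.
  by exists (absz (y + s%:Z)%R); lia.
have [|c3 [c3_cyc mem_c3 top3 old3]] :=
  @ladder c2 (E + 1) (y + 1) 1 k (or_introl erefl) c2_cyc hi2.
  by move=> [a b]; rewrite mem_c2 mem_c1 mem_c !xpair_eqE /=; lia.
have [||c4 [c4_cyc mem_c4 bot4 old4]] :=
  @ladder c3 (E + 1) y (-1) l (or_intror erefl) c3_cyc.
- by apply: old3 lo2 _; rewrite !inE !xpair_eqE; lia.
- by move=> [a b]; rewrite mem_c3 mem_c2 mem_c1 mem_c !xpair_eqE /=; lia.
exists c4; split=> //.
- move=> [a b]; rewrite mem_c4 mem_c3 mem_c2 mem_c1 mem_c !xpair_eqE /=; lia.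
- split; [exists yw|exists y].
    (* The western edge survives because w + e > 0 keeps it off column E. *)
    apply: old4; last by rewrite !inE !xpair_eqE; lia.
    apply: old3; last by rewrite !inE !xpair_eqE; lia.
    apply: old2; last by rewrite !inE !xpair_eqE; lia.
    by apply: old1; last by rewrite !inE !xpair_eqE; lia.
  have -> : e.+2%:Z = E + 1 + 1 by lia.
  apply: old4; last by rewrite !inE !xpair_eqE; lia.
  by apply: old3; last by rewrite !inE !xpair_eqE; lia.
rewrite -def_l -def_k; split; exists (E + 1) => //.
by apply: old4; last by rewrite !inE !xpair_eqE; lia.
Qed.

Lemma holed_grow w e s t i j k l : (0 < w + e)%N -> (0 < s + t)%N ->
  holed w e s t -> holed (i.*2 + w) (j.*2 + e) (k.*2 + s) (l.*2 + t).
Proof.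
have east n w' e' s' t' : (0 < w' + e')%N ->
    holed w' e' s' t' -> holed w' (n.*2 + e') s' t'.
  move=> we0 h; elim: n => [|n IHn] //.
  by rewrite doubleS !addSn; apply: holed_widen => //; lia.
move=> we0 st0 h.
apply/(east j)/holed_flip/(east i); [lia|lia|].
apply/holed_swap/(east l)/holed_flip/(east k); [lia|lia|].
exact/holed_flip/holed_swap/holed_flip.
Qed.

Lemma holed_centre : holed 1 1 1 1.
Proof.
exists [:: (1, 0); (1, 1); (0, 1); (-1, 1); (-1, 0); (-1, -1); (0, -1); (1, -1)].
split=> //.
- by move=> [x y]; rewrite !inE !xpair_eqE /=; lia.
- by split; [exists (-1)|exists 0].
by split; [exists (-1)|exists 0].
Qed.

Lemma holed_corner : holed 0 2 0 2.
Proof.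
exists [:: (1, 0); (2, 0); (2, 1); (2, 2); (1, 2); (0, 2); (0, 1); (1, 1)].
split=> //.
- by move=> [x y]; rewrite !inE !xpair_eqE /=; lia.
- by split; [exists 1|exists 0].
by split; [exists 1|exists 0].
Qed.

(** By symmetry w <= e and s <= t; if the extents are even then e and t are positive
    and even, hence at least 2, and there is room for the corner square. *)
Lemma holed_parity w e s t : (0 < w + e)%N -> (0 < s + t)%N ->
  odd e = odd w -> odd s = odd w -> odd t = odd w -> holed w e s t.
Proof.
move=> we0 st0 oe os ot.
wlog ew : w e we0 oe os ot / (w <= e)%N => [th|].
  have [/th|/ltnW le_ew] := leqP w e; first exact.
  by apply/holed_flip/th; rewrite ?oe //; lia.
wlog ts : s t st0 os ot / (s <= t)%N => [th|].
  have [/th|/ltnW le_ts] := leqP s t; first exact.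
  by apply/holed_swap/holed_flip/holed_swap/th => //; lia.
have half n m : (m <= n)%N -> odd n = odd m -> ((n - m)./2.*2 + m = n)%N by lia.
case: (boolP (odd w)) => ow.
  have := @holed_grow 1 1 1 1 (w - 1)./2 (e - 1)./2 (s - 1)./2 (t - 1)./2
    isT isT holed_centre.
  by rewrite !half //; lia.
have := @holed_grow 0 2 0 2 (w - 0)./2 (e - 2)./2 (s - 0)./2 (t - 2)./2
  isT isT holed_corner.
by rewrite !half //; lia.
Qed.

End HoledRectangles.

(** * Back to the grid graph *)

Lemma map_preimage (S T : eqType) (f : S -> T) (c : seq T) :
  {in c, forall y, exists x, f x = y} -> exists c', map f c' = c.
Proof.
elim: c => [|y c IHc] im_c; first by exists [::].
have [|c' <-] := IHc; first by move=> z zc; apply: im_c; rewrite inE zc orbT.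
by have [x <-] := im_c y (mem_head _ _); exists (x :: c').
Qed.

Theorem theorem3p1 (m n : nat) (u : 'I_m * 'I_n) :
  1 < m -> 1 < n -> odd (m * n) -> even_vertex u ->
  exists c : seq {v : 'I_m * 'I_n | v != u},
    hamilton_cycle (del_vertex (grid m n) u) c.
Proof.
case: u => a b m1 n1; rewrite oddM => /andP[om on] /eqP /= ab_even.
have [lt_a lt_b] := (ltn_ord a, ltn_ord b).
have [|||||c [/andP[c_cyc c_uniq] mem_c _ _]] :=
  @holed_parity a (m - 1 - a) b (n - 1 - b).
1-5: lia.
pose f (v : {v : 'I_m * 'I_n | v != (a, b)}) : int * int :=
  ((val v).1%:Z - a%:Z, (val v).2%:Z - b%:Z)%R.
have f_inj : injective f.
  move=> [[x y] xy] [[x' y'] xy'] [] /= eq_x eq_y; apply/val_inj => /=.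
  by congr pair; apply/val_inj => /=; lia.
have [|c' def_c] := @map_preimage _ _ f c.
  move=> [x y]; rewrite mem_c /= xpair_eqE => /and3P[x_bd y_bd xy0].
  have lt_m : absz (x + a%:Z)%R < m by lia.
  have lt_n : absz (y + b%:Z)%R < n by lia.
  have v_u : (Ordinal lt_m, Ordinal lt_n) != (a, b).
    by rewrite xpair_eqE -!val_eqE /=; lia.
  by exists (exist (fun v => is_true (v != (a, b))) _ v_u); rewrite /f /=; congr pair; lia.
have mem_c' v : v \in c'.
  rewrite -(mem_map f_inj) def_c mem_c; case: v => -[x y] xy; rewrite /f /=.
  have [lt_x lt_y] := (ltn_ord x, ltn_ord y).
  by move: xy; rewrite !xpair_eqE -!val_eqE /=; lia.
have c'_uniq : uniq c' by rewrite -(map_inj_uniq f_inj) def_c.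
exists c'; split=> //; split.
  have -> : size c' = #|{: {v : 'I_m * 'I_n | v != (a, b)}}|.
    by rewrite -(card_uniqP c'_uniq); apply: eq_card => v; rewrite mem_c'.
  by rewrite card_sig cardC1 card_prod !card_ord; nia.
rewrite /ucycle c'_uniq andbT.
move: c_cyc; rewrite -def_c cycle_map; apply: sub_cycle => -[v nv] [v' nv'].
by rewrite /del_vertex /grid /adj /=; lia.
Qed.
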